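(* Let $\Sigma$ be a plural signature. Let $(\mathbf{I},(\mathbf{A},f))$ be an object of $\int_{\mathsf{NPIAlg}(\Sigma)_{\mathsf{s}}}(\mathsf{Alg}(\Sigma)\downarrow_{\mathsf{s}}\cdot)$, let $\boldsymbol{\mathcal{B}}=(\mathbf{P},\mathcal{B})$ be an object of $\int^{\mathsf{NPIAlg}(\Sigma)_{\mathsf{s}}}\mathrm{Lsys}_{\Sigma}$ (so $\mathcal{B}$ is a semi-inductive Lallement system of $\Sigma$-algebras relative to the npi $\Sigma$-algebra $\mathbf{P}$), and let $(t,h)$ be a morphism in $\int_{\mathsf{NPIAlg}(\Sigma)_{\mathsf{s}}}(\mathsf{Alg}(\Sigma)\downarrow_{\mathsf{s}}\cdot)$ from $(\mathbf{I},(\mathbf{A},f))$ to $\mathfrak{L}_{\Sigma}(\boldsymbol{\mathcal{B}})$. Then there exists a non-empty subset $\mathrm{PCgr}(\boldsymbol{\mathcal{B}})\subseteq \mathrm{PCgr}(\mathbf{I},(\mathbf{A},f))$ such that, for every $\overline{\Theta}=(\Theta_{i})_{i\in I}\in \mathrm{PCgr}(\boldsymbol{\mathcal{B}})$, there exists a unique morphism $(s_{\overline{\Theta}},v_{\overline{\Theta}})$ in $\int^{\mathsf{NPIAlg}(\Sigma)_{\mathsf{s}}}\mathrm{Lsys}_{\Sigma}$ from $\boldsymbol{\mathcal{A}}_{\overline{\Theta}}=(\mathbf{I},\mathcal{A}_{\overline{\Theta}})$ to $\boldsymbol{\mathcal{B}}$ such that $$(t,h)=\mathfrak{L}_{\Sigma}(s_{\overline{\Theta}},v_{\overline{\Theta}})\circ(t_{\overline{\Theta}},h_{\overline{\Theta}}),$$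 where $(t_{\overline{\Theta}},h_{\overline{\Theta}})\colon(\mathbf{I},(\mathbf{A},f))\to\mathfrak{L}_{\Sigma}(\boldsymbol{\mathcal{A}}_{\overline{\Theta}})$ is the canonical morphism described in the context.
   Context: A signature is a family $\Sigma=(\Sigma_n)_{n\in\mathbb{N}}$ of sets of $n$-ary operation symbols; it is plural if $\Sigma_0=\varnothing$ and $\Sigma_n\neq\varnothing$ for some $n\geq 2$. We write $n=\{0,\dots,n-1\}$. All $\Sigma$-algebras are non-empty (and have underlying sets in a fixed Grothendieck universe); $F^{\mathbf{A}}_\sigma$ is the operation of $\mathbf{A}$ (underlying set $A$) for $\sigma$. $\mathsf{Alg}(\Sigma)$ is the category of $\Sigma$-algebras and homomorphisms. **npi algebras.** For a $\Sigma$-algebra $\mathbf{I}$, $b\prec_{\mathbf{I}}a$ means that $a=F^{\mathbf{I}}_\sigma((a_j)_{j\in n})$ for some $n\ge 1$, $\sigma\in\Sigma_n$, $(a_j)_{j\in n}\in I^n$ with $b=a_j$ for some $j$; $\leq_{\mathbf{I}}$ is the reflexive transitive closure of $\prec_{\mathbf{I}}$ (homomorphisms are isotone for these preorders). $\mathbf{I}$ is idempotent if $F^{\mathbf{I}}_\sigma(i,\dots,i)=i$ for all $\sigma$ and $i$; it is naturally preordered if every $F^{\mathbf{I}}_\sigma$ is isotone for $\leq_{\mathbf{I}}$ (componentwise on $I^n$). An npi $\Sigma$-algebra is a naturally preordered idempotent one. $\mathsf{NPIAlg}(\Sigma)_{\mathsf{s}}$ is the category of npi $\Sigma$-algebras and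 surjective homomorphisms. **Semi-inductive Lallement systems.** For $\mathbf{I}$ npi, an $\mathbf{I}$-semi-inductive Lallement system is $\mathcal{A}=((\mathbf{A}_i,\mathbf{M}_i)_{i\in I},(f_{i,j})_{i\leq_{\mathbf{I}}j})$ with $\mathbf{A}_i$ a subalgebra of $\mathbf{M}_i$ and homomorphisms $f_{i,j}\colon\mathbf{A}_i\to\mathbf{M}_j$ such that, for all $\sigma\in\Sigma_n$, $(i_k)_{k\in n}\in I^n$ with $i=F^{\mathbf{I}}_\sigma((i_k)_{k\in n})$ and $(a_{k})_{k\in n}\in\prod_{k\in n}A_{i_k}$: (a) $F^{\mathbf{M}_i}_\sigma((f_{i_k,i}(a_k))_{k\in n})\in A_i$; (b) for all $j$ with $i\leq_{\mathbf{I}}j$, $f_{i,j}(F^{\mathbf{M}_i}_\sigma((f_{i_k,i}(a_k))_{k\in n}))=F^{\mathbf{M}_j}_\sigma((f_{i_k,j}(a_k))_{k\in n})$; and (c) for all $i\in I$, $f_{i,i}$ is the inclusion of $\mathbf{A}_i$ in $\mathbf{M}_i$. A morphism from $\mathcal{A}$ to $\mathcal{B}=((\mathbf{B}_i,\mathbf{N}_i)_{i\in I},(g_{i,j})_{i\leq_{\mathbf{I}}j})$ is a family of homomorphisms $u_i\colon\mathbf{M}_i\to\mathbf{N}_i$ with $u_i[A_i]\subseteq B_i$ and, for $i\leq_{\mathbf{I}}j$, $u_j\circ f_{i,j}=g_{i,j}\circ u_i|_{A_i}$. For a homomorphism $t\colon\mathbf{I}\to\mathbf{P}$ and a $\mathbf{P}$-system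 $\mathcal{B}$, $\mathcal{B}_t=((\mathbf{B}_{t(i)},\mathbf{N}_{t(i)})_{i\in I},(g_{t(i),t(j)})_{i\leq_{\mathbf{I}}j})$. **Source category.** $\int^{\mathsf{NPIAlg}(\Sigma)_{\mathsf{s}}}\mathrm{Lsys}_\Sigma$ has objects $\boldsymbol{\mathcal{A}}=(\mathbf{I},\mathcal{A})$, with $\mathbf{I}$ npi and $\mathcal{A}$ an $\mathbf{I}$-semi-inductive Lallement system; a morphism $(\mathbf{I},\mathcal{A})\to(\mathbf{P},\mathcal{B})$ is a pair $(t,u)$ with $t\colon\mathbf{I}\to\mathbf{P}$ a surjective homomorphism and $u\colon\mathcal{A}\to\mathcal{B}_t$ a morphism of $\mathbf{I}$-systems; composition is $(s,v)\circ(t,u)=(s\circ t,(v_{t(i)}\circ u_i)_{i\in I})$. **Target category.** $\int_{\mathsf{NPIAlg}(\Sigma)_{\mathsf{s}}}(\mathsf{Alg}(\Sigma)\downarrow_{\mathsf{s}}\cdot)$ has objects $(\mathbf{I},(\mathbf{A},f))$, with $\mathbf{I}$ npi, $\mathbf{A}$ a $\Sigma$-algebra and $f\colon\mathbf{A}\to\mathbf{I}$ a surjective homomorphism; a morphism $(\mathbf{I},(\mathbf{A},f))\to(\mathbf{P},(\mathbf{B},g))$ is a pair $(t,h)$ with $t\colon\mathbf{I}\to\mathbf{P}$ a surjective homomorphism and $h\colon\mathbf{A}\to\mathbf{B}$ a homomorphism with $t\circ f=g\circ h$; composition is componentwise. **Lallement functor.** The Lallement sum $\boldsymbol{\mathfrak{L}}_\Sigma(\boldsymbol{\mathcal{A}})$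 has underlying set $\coprod_{i\in I}A_i=\bigcup_{i\in I}(A_i\times\{i\})$ and operations $F_\sigma((a_k,i_k)_{k\in n})=(F^{\mathbf{M}_i}_\sigma((f_{i_k,i}(a_k))_{k\in n}),i)$ with $i=F^{\mathbf{I}}_\sigma((i_k)_{k\in n})$; $\mathrm{p}_{\boldsymbol{\mathcal{A}}}\colon\boldsymbol{\mathfrak{L}}_\Sigma(\boldsymbol{\mathcal{A}})\to\mathbf{I}$ is $(a,i)\mapsto i$. The functor $\mathfrak{L}_\Sigma$ sends $\boldsymbol{\mathcal{A}}$ to $(\mathbf{I},(\boldsymbol{\mathfrak{L}}_\Sigma(\boldsymbol{\mathcal{A}}),\mathrm{p}_{\boldsymbol{\mathcal{A}}}))$ and $(t,u)$ to $(t,u^t)$, where $u^t(a,i)=(u_i(a),t(i))$. **Systems associated to $(\mathbf{I},(\mathbf{A},f))$.** For $i\in I$, $\mathbf{A}_i$ is the subalgebra of $\mathbf{A}$ on the fiber $A_i=f^{-1}[\{i\}]$. For $j\in I$, $\mathbf{M}_j$ is the $\Sigma$-algebra on $M_j=\coprod_{i\leq_{\mathbf{I}}j}A_i$ with $F^{\mathbf{M}_j}_\sigma((a_k,i_k)_{k\in n})=(F^{\mathbf{A}}_\sigma((a_k)_{k\in n}),F^{\mathbf{I}}_\sigma((i_k)_{k\in n}))$. For $i\leq_{\mathbf{I}}j$, $\mathrm{in}_{i,j}\colon\mathbf{A}_i\to\mathbf{M}_j$ is $a\mapsto(a,i)$, an injective homomorphism. $\mathrm{PCgr}(\mathbf{I},(\mathbf{A},f))$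 is the set of families $\overline{\Theta}=(\Theta_i)_{i\in I}$ with $\Theta_i$ a congruence on $\mathbf{M}_i$ that preserves $\mathrm{in}_{i,i}[\mathbf{A}_i]$, i.e. the quotient projection $\mathrm{pr}_{\Theta_i}\colon\mathbf{M}_i\to\mathbf{M}_i/\Theta_i$ is injective on $\mathrm{in}_{i,i}[A_i]$. Put $\mathrm{p}_{\Theta_i}=\mathrm{pr}_{\Theta_i}\circ\mathrm{in}_{i,i}\colon\mathbf{A}_i\to\mathbf{M}_i/\Theta_i$ (injective). Then $\mathcal{A}_{\overline{\Theta}}=((\mathrm{p}_{\Theta_i}[\mathbf{A}_i],\mathbf{M}_i/\Theta_i)_{i\in I},(g^{\overline{\Theta}}_{i,j})_{i\leq_{\mathbf{I}}j})$, with $g^{\overline{\Theta}}_{i,j}([(a,i)]_{\Theta_i})=[(a,i)]_{\Theta_j}$ for $a\in A_i$, is an $\mathbf{I}$-semi-inductive Lallement system. The canonical morphism $(t_{\overline{\Theta}},h_{\overline{\Theta}})\colon(\mathbf{I},(\mathbf{A},f))\to\mathfrak{L}_\Sigma(\boldsymbol{\mathcal{A}}_{\overline{\Theta}})$ is given by $t_{\overline{\Theta}}=\mathrm{id}_{\mathbf{I}}$ and $h_{\overline{\Theta}}(a)=(\mathrm{p}_{\Theta_{f(a)}}(a),f(a))$. *)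

(* Defs.v *)
From Stdlib Require Import Relation_Definitions Relation_Operators.
From mathcomp Require Import all_boot generic_quotient.
From mathcomp Require Import boolp classical_sets functions.

Set Implicit Arguments.
Unset Strict Implicit.
Unset Printing Implicit Defensive.

Local Open Scope classical_set_scope.
Local Open Scope quotient_scope.

Definition signature := nat -> Type.

Definition plural (S : signature) : Prop :=
  ~ inhabited (S 0) /\ exists2 n, 2 <= n & inhabited (S n).

(* The arguments of an n-ary operation are indexed by 'I_n = {0, ..., n-1}. *)
Record algebra (S : signature) := Algebra {
  carrier :> Type;
  op : forall n, S n -> ('I_n -> carrier) -> carrier;
  carrier_inhabited : inhabited carrier }.

Arguments op {S} A {n} s a : rename.

Record hom (S : signature) (A B : algebra S) := Hom {
  hom_fun :> A -> B;
  hom_op : forall n (s : S n) (a : 'I_n -> A),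
    hom_fun (op A s a) = op B s (fun k => hom_fun (a k)) }.

Lemma hom_id_subproof (S : signature) (A : algebra S) n (s : S n)
    (a : 'I_n -> A) :
  id (op A s a) = op A s (fun k => id (a k)).
Proof. by []. Qed.

Definition hom_id (S : signature) (A : algebra S) : hom A A :=
  Hom (@hom_id_subproof S A).

Lemma hom_comp_subproof (S : signature) (A B C : algebra S) (g : hom B C)
    (f : hom A B) n (s : S n) (a : 'I_n -> A) :
  (g \o f) (op A s a) = op C s (fun k => (g \o f) (a k)).
Proof. by rewrite /= !hom_op. Qed.

Definition hom_comp (S : signature) (A B C : algebra S) (g : hom B C)
    (f : hom A B) : hom A C :=
  Hom (hom_comp_subproof g f).

Record surj_hom (S : signature) (A B : algebra S) := SurjHom {
  surj_hom_hom :> hom A B;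
  surj_homP : forall b, exists a, surj_hom_hom a = b }.

Lemma surj_hom_id_subproof (S : signature) (A : algebra S) (b : A) :
  exists a, hom_id A a = b.
Proof. by exists b. Qed.

Definition surj_hom_id (S : signature) (A : algebra S) : surj_hom A A :=
  SurjHom (@surj_hom_id_subproof S A).

Lemma surj_hom_comp_subproof (S : signature) (A B C : algebra S)
    (g : surj_hom B C) (f : surj_hom A B) c :
  exists a, hom_comp g f a = c.
Proof.
have [b <-] := surj_homP g c; have [a <-] := surj_homP f b.
by exists a.
Qed.

Definition surj_hom_comp (S : signature) (A B C : algebra S)
    (g : surj_hom B C) (f : surj_hom A B) : surj_hom A C :=
  SurjHom (surj_hom_comp_subproof g f).

Record subalgebra (S : signature) (M : algebra S) := Subalgebra {
  sub_set : set M;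
  sub_neq0 : sub_set !=set0;
  sub_op : forall n (s : S n) (a : 'I_n -> M),
    (forall k, sub_set (a k)) -> sub_set (op M s a) }.

Lemma sub_inhabited (S : signature) (M : algebra S) (A : subalgebra M) :
  inhabited {x : M | sub_set A x}.
Proof. by have [x Ax] := sub_neq0 A; exists; exists x. Qed.

Definition sub_alg (S : signature) (M : algebra S) (A : subalgebra M) :
    algebra S :=
  @Algebra S {x : M | sub_set A x}
    (fun n s a => exist _ (op M s (fun k => sval (a k)))
                    (sub_op s (fun k => svalP (a k))))
    (sub_inhabited A).

Coercion sub_alg : subalgebra >-> algebra.

Lemma image_neq0 (S : signature) (A B : algebra S) (f : hom A B) :
  range f !=set0.
Proof. by have [a] := carrier_inhabited A; exists (f a), a. Qed.

Lemma image_op (S : signature) (A B : algebra S) (f : hom A B) n (s : S n)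
    (b : 'I_n -> B) :
  (forall k, range f (b k)) -> range f (op B s b).
Proof.
move=> bf; pose a k := s2val (cid2 (bf k)).
exists (op A s a) => //; rewrite hom_op; congr (op B s _).
by apply/funext => k; rewrite /a; case: (cid2 (bf k)).
Qed.

Definition image_subalg (S : signature) (A B : algebra S) (f : hom A B) :
    subalgebra B :=
  Subalgebra (image_neq0 f) (@image_op S A B f).

Record congruence (S : signature) (M : algebra S) := Congruence {
  cong_rel :> M -> M -> Prop;
  cong_equivalence : equivalence M cong_rel;
  cong_op : forall n (s : S n) (x y : 'I_n -> M),
    (forall k, cong_rel (x k) (y k)) -> cong_rel (op M s x) (op M s y) }.

(* [generic_quotient] needs a choiceType and a boolean relation, hence
   [{classic M}] and [asbool]. *)
Definition cong_bool (S : signature) (M : algebra S) (T : congruence M) :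
    rel {classic M} :=
  fun x y => `[< T x y >].

Lemma cong_bool_refl (S : signature) (M : algebra S) (T : congruence M) :
  reflexive (cong_bool T).
Proof. by move=> x; apply/asboolP; have [] := cong_equivalence T. Qed.

Lemma cong_bool_sym (S : signature) (M : algebra S) (T : congruence M) :
  symmetric (cong_bool T).
Proof.
have [_ _ Tsym] := cong_equivalence T.
by move=> x y; apply/asboolP/asboolP; apply: Tsym.
Qed.

Lemma cong_bool_trans (S : signature) (M : algebra S) (T : congruence M) :
  transitive (cong_bool T).
Proof.
have [_ Ttrans _] := cong_equivalence T.
by move=> y x z /asboolP xy /asboolP yz; apply/asboolP; apply: Ttrans yz.
Qed.

Definition cong_equiv_rel (S : signature) (M : algebra S) (T : congruence M) :
    equiv_rel {classic M} :=
  EquivRel (cong_bool T) (cong_bool_refl T) (cong_bool_sym T)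
    (@cong_bool_trans S M T).

Definition quot_carrier (S : signature) (M : algebra S) (T : congruence M) :
    Type :=
  {eq_quot cong_equiv_rel T}.

Definition quot_pi (S : signature) (M : algebra S) (T : congruence M) (x : M) :
    quot_carrier T :=
  \pi_({eq_quot cong_equiv_rel T}) (x : {classic M}).

Definition quot_repr (S : signature) (M : algebra S) (T : congruence M)
    (q : quot_carrier T) : M :=
  repr (q : {eq_quot cong_equiv_rel T}).

Lemma quot_piK (S : signature) (M : algebra S) (T : congruence M) :
  cancel (@quot_repr S M T) (@quot_pi S M T).
Proof. by move=> q; apply: reprK. Qed.

Lemma quot_piP (S : signature) (M : algebra S) (T : congruence M) (x y : M) :
  quot_pi T x = quot_pi T y <-> T x y.
Proof.
split=> [/(@eqmodP _ (cong_equiv_rel T))/asboolP //|Txy].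
by apply/(@eqmodP _ (cong_equiv_rel T))/asboolP.
Qed.

Lemma quot_inhabited (S : signature) (M : algebra S) (T : congruence M) :
  inhabited (quot_carrier T).
Proof. by have [x] := carrier_inhabited M; exists; apply: quot_pi x. Qed.

Definition quot_alg (S : signature) (M : algebra S) (T : congruence M) :
    algebra S :=
  @Algebra S (quot_carrier T)
    (fun n s q => quot_pi T (op M s (fun k => quot_repr (q k))))
    (quot_inhabited T).

Lemma quot_pi_op (S : signature) (M : algebra S) (T : congruence M) n (s : S n)
    (x : 'I_n -> M) :
  quot_pi T (op M s x) = op (quot_alg T) s (fun k => quot_pi T (x k)).
Proof.
apply/quot_piP; apply: cong_op => k; apply/quot_piP.
by rewrite quot_piK.
Qed.

Definition quot_pr (S : signature) (M : algebra S) (T : congruence M) :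
    hom M (quot_alg T) :=
  @Hom S M (quot_alg T) (quot_pi T) (@quot_pi_op S M T).

(* The smaller element is the first argument of [nprec] and [nle]. *)
Definition nprec (S : signature) (I : algebra S) : relation I :=
  fun b a => exists n (s : S n) (x : 'I_n -> I),
    [/\ 1 <= n, a = op I s x & exists k, b = x k].

Definition nle (S : signature) (I : algebra S) : relation I :=
  clos_refl_trans I (@nprec S I).

Arguments nprec {S I} b a.
Arguments nle {S I} b a.

Definition idempotent_algebra (S : signature) (I : algebra S) : Prop :=
  forall n (s : S n) (i : I), op I s (fun=> i) = i.

Definition naturally_preordered (S : signature) (I : algebra S) : Prop :=
  forall n (s : S n) (x y : 'I_n -> I),
    (forall k, nle (x k) (y k)) -> nle (op I s x) (op I s y).

Record npi_algebra (S : signature) := NpiAlgebra {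
  npi_alg :> algebra S;
  npi_idempotent : idempotent_algebra npi_alg;
  npi_preordered : naturally_preordered npi_alg }.

Lemma nle_refl (S : signature) (I : algebra S) (i : I) : nle i i.
Proof. exact: rt_refl. Qed.

Lemma nle_trans (S : signature) (I : algebra S) (i j k : I) :
  nle i j -> nle j k -> nle i k.
Proof. exact: rt_trans. Qed.

Lemma nle_op (S : signature) (I : algebra S) n (s : S n) (x : 'I_n -> I) i :
  i = op I s x -> forall k, nle (x k) i.
Proof.
move=> -> k; apply: rt_step; exists n, s, x; split=> //; last by exists k.
exact: leq_ltn_trans (ltn_ord k).
Qed.

Lemma hom_nle (S : signature) (I P : algebra S) (t : hom I P) (i j : I) :
  nle i j -> nle (t i) (t j).
Proof.
elim=> [x y [n [s [a [n0 -> [k ->]]]]]|x|x y z _ xy _ yz].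
- apply: rt_step; exists n, s, (fun k => t (a k)); split=> //.
    by rewrite hom_op.
  by exists k.
- exact: nle_refl.
- exact: nle_trans yz.
Qed.

Lemma hom_eq_op (S : signature) (I P : algebra S) (t : hom I P) n (s : S n)
    (x : 'I_n -> I) i :
  i = op I s x -> t i = op P s (fun k => t (x k)).
Proof. by move=> ->; rewrite hom_op. Qed.

Lemma npi_op_nle (S : signature) (I : npi_algebra S) n (s : S n)
    (x : 'I_n -> I) j :
  (forall k, nle (x k) j) -> nle (op I s x) j.
Proof. by move=> xj; rewrite -(npi_idempotent s j); apply: npi_preordered. Qed.

(* The index i = F(x) is quantified together with the equation [e], rather than
   substituted, so that pulling back along a homomorphism needs no transport. *)
Record lsys (S : signature) (I : npi_algebra S) := Lsys {
  lsys_M : I -> algebra S;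
  lsys_A : forall i, subalgebra (lsys_M i);
  lsys_f : forall i j, nle i j -> hom (lsys_A i) (lsys_M j);
  lsys_closed : forall n (s : S n) (x : 'I_n -> I) i (e : i = op I s x)
      (a : forall k, lsys_A (x k)),
    sub_set (lsys_A i)
      (op (lsys_M i) s (fun k => lsys_f (nle_op e k) (a k)));
  lsys_f_op : forall n (s : S n) (x : 'I_n -> I) i (e : i = op I s x)
      (a : forall k, lsys_A (x k)) j (ij : nle i j),
    lsys_f ij (exist _ _ (lsys_closed e a)) =
    op (lsys_M j) s (fun k => lsys_f (nle_trans (nle_op e k) ij) (a k));
  lsys_f_id : forall i (a : lsys_A i), lsys_f (nle_refl i) a = sval a }.

Arguments lsys_f {S I} A {i j} ij : rename.
Arguments lsys_closed {S I} A {n s x i} e a : rename.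

Record lsys_hom (S : signature) (I : npi_algebra S) (A B : lsys I) := LsysHom {
  lsys_hom_fun :> forall i, hom (lsys_M A i) (lsys_M B i);
  lsys_hom_sub : forall i x,
    sub_set (lsys_A A i) x -> sub_set (lsys_A B i) (lsys_hom_fun i x);
  lsys_hom_comm : forall i j (ij : nle i j) (a : lsys_A A i),
    lsys_hom_fun j (lsys_f A ij a) =
    lsys_f B ij (exist _ (lsys_hom_fun i (sval a)) (lsys_hom_sub (svalP a))) }.

Section Pullback.
Variables (S : signature) (I P : npi_algebra S) (t : hom I P) (B : lsys P).

Let pull_f i j (ij : nle i j) :
  hom (lsys_A B (t i)) (lsys_M B (t j)) := lsys_f B (hom_nle t ij).

Lemma lsys_pull_closed n (s : S n) (x : 'I_n -> I) i (e : i = op I s x)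
    (a : forall k, lsys_A B (t (x k))) :
  sub_set (lsys_A B (t i))
    (op (lsys_M B (t i)) s (fun k => pull_f (nle_op e k) (a k))).
Proof.
have := lsys_closed B (hom_eq_op t e) a.
congr (sub_set _ (op _ s _)); apply/funext => k.
by congr (lsys_f B _ _); apply: Prop_irrelevance.
Qed.

Lemma lsys_pull_f_op n (s : S n) (x : 'I_n -> I) i (e : i = op I s x)
    (a : forall k, lsys_A B (t (x k))) j (ij : nle i j) :
  pull_f ij (exist _ _ (lsys_pull_closed e a)) =
  op (lsys_M B (t j)) s (fun k => pull_f (nle_trans (nle_op e k) ij) (a k)).
Proof.
have := lsys_f_op (hom_eq_op t e) a (hom_nle t ij).
have -> : exist _ _ (lsys_closed B (hom_eq_op t e) a) =
          exist _ _ (lsys_pull_closed e a).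
  apply: eq_exist; congr (op _ s _); apply/funext => k.
  by congr (lsys_f B _ _); apply: Prop_irrelevance.
rewrite /pull_f => ->; congr (op _ s _); apply/funext => k.
by congr (lsys_f B _ _); apply: Prop_irrelevance.
Qed.

Lemma lsys_pull_f_id i (a : lsys_A B (t i)) : pull_f (nle_refl i) a = sval a.
Proof.
rewrite -lsys_f_id /pull_f.
by congr (lsys_f B _ _); apply: Prop_irrelevance.
Qed.

Definition lsys_pull : lsys I := Lsys lsys_pull_f_op lsys_pull_f_id.

End Pullback.

Record lsys_obj (S : signature) := LsysObj {
  lobj_I : npi_algebra S;
  lobj_sys : lsys lobj_I }.

(* The Prop components of morphisms are irrelevant under the axioms of [boolp],
   so Leibniz equality of morphisms is equality of the underlying maps. *)
Record lsys_mor (S : signature) (X Y : lsys_obj S) := LsysMor {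
  lmor_t : surj_hom (lobj_I X) (lobj_I Y);
  lmor_u : lsys_hom (lobj_sys X) (lsys_pull lmor_t (lobj_sys Y)) }.

Record over_obj (S : signature) := OverObj {
  oobj_I : npi_algebra S;
  oobj_A : algebra S;
  oobj_f : surj_hom oobj_A oobj_I }.

Record over_mor (S : signature) (X Y : over_obj S) := OverMor {
  omor_t : surj_hom (oobj_I X) (oobj_I Y);
  omor_h : hom (oobj_A X) (oobj_A Y);
  omor_comm : forall a, omor_t (oobj_f X a) = oobj_f Y (omor_h a) }.

Lemma over_comp_subproof (S : signature) (X Y Z : over_obj S)
    (g : over_mor Y Z) (f : over_mor X Y) a :
  surj_hom_comp (omor_t g) (omor_t f) (oobj_f X a) =
  oobj_f Z (hom_comp (omor_h g) (omor_h f) a).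
Proof. by rewrite /= !omor_comm. Qed.

Definition over_comp (S : signature) (X Y Z : over_obj S) (g : over_mor Y Z)
    (f : over_mor X Y) : over_mor X Z :=
  OverMor (over_comp_subproof g f).

Section LallementSum.
Variables (S : signature) (X : lsys_obj S).
Let I := lobj_I X.
Let A := lobj_sys X.

(* The pair (a, i) is [existT _ i a]. *)
Definition lsum_carrier : Type := {i : I & lsys_A A i}.

Definition lsum_op n (s : S n) (x : 'I_n -> lsum_carrier) : lsum_carrier :=
  existT _ (op I s (fun k => projT1 (x k)))
    (exist _ _ (lsys_closed A erefl (fun k => projT2 (x k)))).

Lemma lsum_inhabited : inhabited lsum_carrier.
Proof.
have [i] := carrier_inhabited I; have [a] := carrier_inhabited (lsys_A A i).
by exists; exists i.
Qed.

Definition lsum : algebra S := Algebra lsum_op lsum_inhabited.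

Lemma lsum_p_op n (s : S n) (x : 'I_n -> lsum) :
  projT1 (op lsum s x) = op I s (fun k => projT1 (x k)).
Proof. by []. Qed.

Lemma lsum_p_surj i : exists x, Hom lsum_p_op x = i.
Proof.
have [a] := carrier_inhabited (lsys_A A i).
by exists (existT _ i a).
Qed.

Definition lsum_p : surj_hom lsum I := SurjHom lsum_p_surj.

Definition lallement_obj : over_obj S := OverObj lsum_p.

Lemma lsum_opE n (s : S n) (x : 'I_n -> I) i (e : i = op I s x)
    (a : forall k, lsys_A A (x k)) (b : lsys_A A i) :
  sval b = op (lsys_M A i) s (fun k => lsys_f A (nle_op e k) (a k)) ->
  existT _ i b = op lsum s (fun k => existT _ (x k) (a k)).
Proof.
subst i => bE; congr (existT _ _ _).
by case: b bE => b Ab /= bE; apply: eq_exist.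
Qed.

End LallementSum.

Section LallementMor.
Variables (S : signature) (X Y : lsys_obj S) (m : lsys_mor X Y).
Let t := lmor_t m.
Let u := lmor_u m.

Definition lsum_map (x : lsum X) : lsum Y :=
  existT _ (t (projT1 x))
    (exist _ (u (projT1 x) (sval (projT2 x)))
       (lsys_hom_sub u (svalP (projT2 x)))).

Lemma lsum_map_op n (s : S n) (x : 'I_n -> lsum X) :
  lsum_map (op (lsum X) s x) = op (lsum Y) s (fun k => lsum_map (x k)).
Proof.
rewrite [LHS]/lsum_map.
apply: (lsum_opE (e := hom_eq_op t erefl)).
apply: etrans; first exact: (hom_op (u _)).
congr (op _ s _); apply/funext => k.
rewrite lsys_hom_comm /=.
by congr (lsys_f _ _ _); apply: Prop_irrelevance.
Qed.

Lemma lallement_mor_comm x :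
  t (lsum_p X x) = lsum_p Y (Hom lsum_map_op x).
Proof. by []. Qed.

Definition lallement_mor : over_mor (lallement_obj X) (lallement_obj Y) :=
  @OverMor S (lallement_obj X) (lallement_obj Y) t (Hom lsum_map_op)
    lallement_mor_comm.

End LallementMor.

Section AssociatedSystems.
Variables (S : signature) (X : over_obj S).
Let I := oobj_I X.
Let A := oobj_A X.
Let f := oobj_f X.

Lemma fiber_neq0 i : f @^-1` [set i] !=set0.
Proof. by have [a fa] := surj_homP f i; exists a. Qed.

Lemma fiber_closed i n (s : S n) (a : 'I_n -> A) :
  (forall k, (f @^-1` [set i]) (a k)) -> (f @^-1` [set i]) (op A s a).
Proof.
move=> fa; rewrite /preimage /= hom_op -[RHS](npi_idempotent s i).
by congr (op _ s _); apply/funext => k; apply: fa.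
Qed.

Definition fiber (i : I) : subalgebra A :=
  Subalgebra (fiber_neq0 i) (@fiber_closed i).

(* The pair (a, i), for i <= j and a in the fiber of i, is
   [existT _ (exist _ i ij) a] where [ij : nle i j]. *)
Definition under_carrier (j : I) : Type :=
  {i : {i : I | nle i j} & fiber (sval i)}.

Definition under_pt i j (ij : nle i j) (a : fiber i) : under_carrier j :=
  existT _ (exist _ i ij) a.

Definition under_idx j (x : under_carrier j) : I := sval (projT1 x).

Definition under_val j (x : under_carrier j) : A := sval (projT2 x).

Lemma under_idx_le j (x : under_carrier j) : nle (under_idx x) j.
Proof. exact: svalP (projT1 x). Qed.

Lemma under_f j (x : under_carrier j) : f (under_val x) = under_idx x.
Proof. exact: svalP (projT2 x). Qed.

Lemma under_val_inj j : injective (@under_val j).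
Proof.
move=> [[i ij] [a fa]] [[i' ij'] [a' fa']]; rewrite /under_val /= => aa'.
have ii' : i = i' by rewrite /= in fa fa'; rewrite -fa -fa' aa'.
subst i'; have -> : ij' = ij by apply: Prop_irrelevance.
by congr (existT _ _ _); apply: eq_exist.
Qed.

Lemma under_op_f j n (s : S n) (x : 'I_n -> under_carrier j) :
  f (op A s (fun k => under_val (x k))) = op I s (fun k => under_idx (x k)).
Proof.
by rewrite hom_op; congr (op _ s _); apply/funext => k; apply: under_f.
Qed.

Definition under_op j n (s : S n) (x : 'I_n -> under_carrier j) :
    under_carrier j :=
  under_pt (npi_op_nle s (fun k => under_idx_le (x k)))
    (exist _ (op A s (fun k => under_val (x k))) (under_op_f s x)).

Lemma under_inhabited j : inhabited (under_carrier j).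
Proof.
have [a] := carrier_inhabited (fiber j).
by exists; apply: (under_pt (nle_refl j) a).
Qed.

Definition under_alg (j : I) : algebra S :=
  Algebra (@under_op j) (under_inhabited j).

Lemma under_pt_op i j (ij : nle i j) n (s : S n) (a : 'I_n -> fiber i) :
  under_pt ij (op (fiber i) s a) =
  op (under_alg j) s (fun k => under_pt ij (a k)).
Proof. exact: under_val_inj. Qed.

Definition under_in i j (ij : nle i j) : hom (fiber i) (under_alg j) :=
  @Hom S (fiber i) (under_alg j) (under_pt ij) (@under_pt_op i j ij).

Definition preserves_fiber i (T : congruence (under_alg i)) : Prop :=
  set_inj (range (under_in (nle_refl i))) (quot_pr T).

Record PCgr := PCgrFamily {
  pcgr_cong :> forall i, congruence (under_alg i);
  pcgr_preserves : forall i, preserves_fiber (pcgr_cong i) }.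

Section AssociatedLsys.
Variable T : PCgr.

Definition pcgr_p i : hom (fiber i) (quot_alg (T i)) :=
  hom_comp (quot_pr (T i)) (under_in (nle_refl i)).

Lemma pcgr_p_inj i : injective (@pcgr_p i).
Proof.
move=> a b /(pcgr_preserves (p := T)) ab.
have /(congr1 (@under_val _)) : under_in (nle_refl i) a = under_in (nle_refl i) b.
  by apply: ab; apply/mem_set; [exists a|exists b].
by case: a b {ab} => [a fa] [b fb] /= ab; apply: eq_exist.
Qed.

(* [pcgr_g ij] sends [p a] to the class of (a, i) modulo [T j]; this is
   [pcgr_gE] below. *)
Definition pcgr_g_fun i j (ij : nle i j) (q : image_subalg (pcgr_p i)) :
    quot_alg (T j) :=
  quot_pr (T j) (under_in ij (s2val (cid2 (svalP q)))).

Lemma pcgr_g_funE i j (ij : nle i j) (a : fiber i)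
    (Ha : range (pcgr_p i) (pcgr_p i a)) :
  pcgr_g_fun ij (exist _ (pcgr_p i a) Ha) = quot_pr (T j) (under_in ij a).
Proof.
rewrite /pcgr_g_fun; case: (cid2 _) => b _ ba /=.
by rewrite (pcgr_p_inj ba).
Qed.

Lemma pcgr_imageP i (q : image_subalg (pcgr_p i)) :
  exists a Ha, q = exist _ (pcgr_p i a) Ha.
Proof.
case: q => y Hy; have [a _ ay] := Hy.
by exists a, (imageT (pcgr_p i) a); apply: eq_exist.
Qed.

Lemma pcgr_g_op i j (ij : nle i j) n (s : S n)
    (q : 'I_n -> image_subalg (pcgr_p i)) :
  pcgr_g_fun ij (op (image_subalg (pcgr_p i)) s q) =
  op (quot_alg (T j)) s (fun k => pcgr_g_fun ij (q k)).
Proof.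
have [a qE] := choice (fun k => pcgr_imageP (q k)).
transitivity (quot_pr (T j) (under_in ij (op (fiber i) s a))).
  rewrite -(pcgr_g_funE ij (imageT (pcgr_p i) _)); congr pcgr_g_fun.
  apply: eq_exist; rewrite hom_op; congr (op _ s _); apply/funext => k.
  by have [Ha ->] := qE k.
rewrite !hom_op; congr (op _ s _); apply/funext => k.
by have [Ha ->] := qE k; rewrite pcgr_g_funE.
Qed.

Definition pcgr_g i j (ij : nle i j) :
    hom (image_subalg (pcgr_p i)) (quot_alg (T j)) :=
  @Hom S (image_subalg (pcgr_p i)) (quot_alg (T j)) (pcgr_g_fun ij)
    (@pcgr_g_op i j ij).

Lemma pcgr_gE i j (ij : nle i j) (a : fiber i)
    (Ha : range (pcgr_p i) (pcgr_p i a)) :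
  pcgr_g ij (exist _ (pcgr_p i a) Ha) = quot_pr (T j) (under_in ij a).
Proof. exact: pcgr_g_funE. Qed.

Lemma fiber_op_f n (s : S n) (x : 'I_n -> I) i (e : i = op I s x)
    (a : forall k, fiber (x k)) :
  f (op A s (fun k => sval (a k))) = i.
Proof.
rewrite hom_op e; congr (op _ s _); apply/funext => k.
exact: svalP (a k).
Qed.

Definition fiber_op n (s : S n) (x : 'I_n -> I) i (e : i = op I s x)
    (a : forall k, fiber (x k)) : fiber i :=
  exist _ (op A s (fun k => sval (a k))) (fiber_op_f e a).

Lemma pcgr_g_fiber n (s : S n) (x : 'I_n -> I) i (e : i = op I s x)
    (q : forall k, image_subalg (pcgr_p (x k))) (a : forall k, fiber (x k)) :
  (forall k, exists Ha, q k = exist _ (pcgr_p (x k) (a k)) Ha) ->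
  forall j (xj : forall k, nle (x k) j) (ij : nle i j),
  op (quot_alg (T j)) s (fun k => pcgr_g (xj k) (q k)) =
  quot_pr (T j) (under_in ij (fiber_op e a)).
Proof.
move=> qE j xj ij.
have -> : under_in ij (fiber_op e a) =
          op (under_alg j) s (fun k => under_in (xj k) (a k)).
  exact: under_val_inj.
rewrite hom_op; congr (op _ s _); apply/funext => k.
by have [Ha ->] := qE k; rewrite pcgr_gE.
Qed.

Lemma pcgr_closed n (s : S n) (x : 'I_n -> I) i (e : i = op I s x)
    (q : forall k, image_subalg (pcgr_p (x k))) :
  sub_set (image_subalg (pcgr_p i))
    (op (quot_alg (T i)) s (fun k => pcgr_g (nle_op e k) (q k))).
Proof.
pose a k := s2val (cid2 (svalP (q k))).
have qE k : exists Ha, q k = exist _ (pcgr_p (x k) (a k)) Ha.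
  exists (imageT _ _); rewrite /a; case: (q k) => [y Hy] /=.
  by apply: eq_exist; case: (cid2 _).
by rewrite (pcgr_g_fiber e qE _ (nle_refl i)); exists (fiber_op e a).
Qed.

Lemma pcgr_f_op n (s : S n) (x : 'I_n -> I) i (e : i = op I s x)
    (q : forall k, image_subalg (pcgr_p (x k))) j (ij : nle i j) :
  pcgr_g ij (exist _ _ (pcgr_closed e q)) =
  op (quot_alg (T j)) s (fun k => pcgr_g (nle_trans (nle_op e k) ij) (q k)).
Proof.
pose a k := s2val (cid2 (svalP (q k))).
have qE k : exists Ha, q k = exist _ (pcgr_p (x k) (a k)) Ha.
  exists (imageT _ _); rewrite /a; case: (q k) => [y Hy] /=.
  by apply: eq_exist; case: (cid2 _).
rewrite (pcgr_g_fiber e qE _ ij) -(pcgr_gE ij (imageT (pcgr_p i) _)).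
by congr (pcgr_g ij _); apply: eq_exist; rewrite (pcgr_g_fiber e qE _ (nle_refl i)).
Qed.

Lemma pcgr_f_id i (q : image_subalg (pcgr_p i)) : pcgr_g (nle_refl i) q = sval q.
Proof. by have [a [Ha ->]] := pcgr_imageP q; rewrite pcgr_gE. Qed.

Definition assoc_lsys : lsys I := Lsys pcgr_f_op pcgr_f_id.

Definition assoc_obj : lsys_obj S := LsysObj assoc_lsys.

Definition canonical_fun (a : A) : lsum assoc_obj :=
  existT _ (f a)
    (exist _ (pcgr_p (f a) (exist _ a erefl)) (imageT (pcgr_p (f a)) _)).

Lemma canonical_fun_op n (s : S n) (a : 'I_n -> A) :
  canonical_fun (op A s a) =
  op (lsum assoc_obj) s (fun k => canonical_fun (a k)).
Proof.
apply: (@lsum_opE S assoc_obj n s (fun k => f (a k)) _ (hom_op f s a)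
  (fun k => projT2 (canonical_fun (a k)))) => /=.
pose b k : fiber (f (a k)) := exist _ (a k) erefl.
have qE k : exists Ha, exist _ (pcgr_p (f (a k)) (b k))
    (imageT (pcgr_p (f (a k))) (b k)) = exist _ (pcgr_p (f (a k)) (b k)) Ha.
  by eexists.
apply: etrans (esym (pcgr_g_fiber (hom_op f s a) qE _ (nle_refl _))).
by congr (quot_pi _ _); apply: under_val_inj.
Qed.

Lemma canonical_comm a :
  surj_hom_id I (f a) = lsum_p assoc_obj (Hom canonical_fun_op a).
Proof. by []. Qed.

Definition canonical_mor : over_mor X (lallement_obj assoc_obj) :=
  @OverMor S X (lallement_obj assoc_obj) (surj_hom_id I) (Hom canonical_fun_op)
    canonical_comm.

End AssociatedLsys.

End AssociatedSystems.

(* Main.v *)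
Require Import Defs.
From mathcomp Require Import all_boot boolp classical_sets functions.

Set Implicit Arguments.
Unset Strict Implicit.
Unset Printing Implicit Defensive.

Local Open Scope classical_set_scope.

(** The map (a, i) |-> g_(t i, t j) (h a) is a homomorphism from M_j to N_(t j).
    For PCgr(B) take the families whose j-th member lies in the kernel of this
    homomorphism for every j; the family of equality relations is one of them.
    The homomorphism then factors through M_j / Theta_j, which gives v_j.
    Uniqueness holds because every class of M_j / Theta_j is the image under
    g_(i, j) of a class coming from A_i, on which v_i is dictated by h. *)

(** * Extensionality of morphisms *)

Lemma hom_ext (S : signature) (A B : algebra S) (f g : hom A B) :
  f =1 g -> f = g.
Proof.
case: f g => [f fop] [g gop] /= /funext fg; subst g.
by congr Hom; apply: Prop_irrelevance.
Qed.

Lemma surj_hom_ext (S : signature) (A B : algebra S) (f g : surj_hom A B) :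
  f =1 g -> f = g.
Proof.
case: f g => [f fs] [g gs] /= /hom_ext fg; subst g.
by congr SurjHom; apply: Prop_irrelevance.
Qed.

Lemma over_mor_ext (S : signature) (X Y : over_obj S) (m m' : over_mor X Y) :
  omor_t m =1 omor_t m' -> omor_h m =1 omor_h m' -> m = m'.
Proof.
case: m m' => [t h c] [t' h' c'] /= /surj_hom_ext tt' /hom_ext hh'.
by subst t' h'; congr OverMor; apply: Prop_irrelevance.
Qed.

Lemma lsys_hom_ext (S : signature) (I : npi_algebra S) (A B : lsys I)
    (u v : lsys_hom A B) :
  (forall i, u i =1 v i) -> u = v.
Proof.
case: u v => [u us uc] [v vs vc] /= uv.
have {}uv : u = v by apply: functional_extensionality_dep => i; exact: hom_ext.
(* The types of [uc] and [vc] mention [us] and [vs], so these are identified first. *)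
subst v; have ? : us = vs by apply: Prop_irrelevance.
by subst vs; congr LsysHom; apply: Prop_irrelevance.
Qed.

(** * Structure maps on points of the Lallement sum *)

Section LallementExtension.
Variables (S : signature) (B : lsys_obj S).
Let P := lobj_I B.
Let N := lobj_sys B.

(** The source index is read off from [y], so that equalities between points of the sum can be
    substituted without transport. *)
Definition lsum_f (y : lsum B) j (yj : nle (lsum_p B y) j) : lsys_M N j :=
  lsys_f N yj (projT2 y).

Lemma lsum_f_congr (y z : lsum B) j (yj : nle (lsum_p B y) j)
    (zj : nle (lsum_p B z) j) :
  y = z -> lsum_f yj = lsum_f zj.
Proof. by move=> yz; subst z; congr lsum_f; apply: Prop_irrelevance. Qed.

Lemma lsum_f_op n (s : S n) (y : 'I_n -> lsum B) j
    (yj : nle (lsum_p B (op (lsum B) s y)) j)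
    (ykj : forall k, nle (lsum_p B (y k)) j) :
  lsum_f yj = op (lsys_M N j) s (fun k => lsum_f (ykj k)).
Proof.
apply: etrans; first exact: (lsys_f_op erefl (fun k => projT2 (y k)) yj).
congr (op _ s _); apply/funext => k.
by congr (lsys_f N _ _); apply: Prop_irrelevance.
Qed.

Lemma lsum_f_sub (y : lsum B) j (yj : nle (lsum_p B y) j) :
  lsum_p B y = j -> sub_set (lsys_A N j) (lsum_f yj).
Proof.
move=> e; subst j; have -> : yj = nle_refl _ by apply: Prop_irrelevance.
by rewrite /lsum_f lsys_f_id; apply: svalP.
Qed.

(** Once [j] is the index of [y], the structure map is an inclusion. This recovers [h a] from its
    value under [under_hom]. *)
Lemma lsum_f_pt (y : lsum B) j (yj : nle (lsum_p B y) j)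
    (Ny : sub_set (lsys_A N j) (lsum_f yj)) :
  lsum_p B y = j -> existT _ j (exist _ (lsum_f yj) Ny) = y.
Proof.
move=> e; subst j; case: y yj Ny => i a yj Ny /=; congr existT.
have yE : yj = nle_refl _ by apply: Prop_irrelevance.
case: a yj Ny yE => a Na yj Ny yE; apply: eq_exist.
by rewrite /lsum_f yE lsys_f_id.
Qed.

End LallementExtension.

(** * The homomorphisms from M_j to N_(t j) induced by [th] *)

Section UnderHom.
Variables (S : signature) (X : over_obj S) (B : lsys_obj S).
Variable th : over_mor X (lallement_obj B).
Let I := oobj_I X.
Let N := lobj_sys B.
Let t : surj_hom I (lobj_I B) := omor_t th.
Let h : hom (oobj_A X) (lsum B) := omor_h th.

Lemma omor_under_idx j (x : under_alg j) :
  lsum_p B (h (under_val x)) = t (under_idx x).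
Proof. by rewrite -under_f [RHS](omor_comm th). Qed.

Lemma omor_under_le j (x : under_alg j) :
  nle (lsum_p B (h (under_val x))) (t j).
Proof. by rewrite omor_under_idx; apply: hom_nle; apply: under_idx_le. Qed.

Definition under_hom_fun j (x : under_alg j) : lsys_M N (t j) :=
  lsum_f (omor_under_le x).

Lemma under_hom_op j n (s : S n) (x : 'I_n -> under_alg j) :
  under_hom_fun (op (under_alg j) s x) =
  op (lsys_M N (t j)) s (fun k => under_hom_fun (x k)).
Proof.
have hx : h (under_val (op (under_alg j) s x)) =
          op (lsum B) s (fun k => h (under_val (x k))) by exact: hom_op.
(* [lsum_f_congr] asks for a bound on each side of [hx]. *)
have le := omor_under_le (op (under_alg j) s x); rewrite hx in le.
rewrite /under_hom_fun (lsum_f_congr _ le hx).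
exact: lsum_f_op.
Qed.

Definition under_hom j : hom (under_alg j) (lsys_M N (t j)) :=
  Hom (@under_hom_op j).

Definition pcgr_below_kernel : set (PCgr X) :=
  [set T : PCgr X | forall j x y, T j x y -> under_hom j x = under_hom j y].

(** * Factorisation through the quotients *)

Section Factor.
Variables (T : PCgr X) (DT : pcgr_below_kernel T).

Definition factor_fun j (q : quot_alg (T j)) : lsys_M N (t j) :=
  under_hom j (quot_repr q).

Lemma factor_pr j (x : under_alg j) :
  factor_fun (quot_pr (T j) x) = under_hom j x.
Proof. by apply: DT; apply/quot_piP; rewrite quot_piK. Qed.

Lemma factor_op j n (s : S n) (q : 'I_n -> quot_alg (T j)) :
  factor_fun (op (quot_alg (T j)) s q) =
  op (lsys_M N (t j)) s (fun k => factor_fun (q k)).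
(* An operation of the quotient is by definition the class of an operation on representatives, so
   [factor_pr] applies by conversion. *)
Proof. by rewrite [LHS]factor_pr hom_op. Qed.

Definition factor j : hom (quot_alg (T j)) (lsys_M N (t j)) :=
  Hom (@factor_op j).

Lemma factor_sub j q :
  sub_set (lsys_A (assoc_lsys T) j) q ->
  sub_set (lsys_A (lsys_pull t N) j) (factor j q).
Proof.
move=> [a _ <-]; rewrite [factor j _]factor_pr.
by apply: lsum_f_sub; exact: omor_under_idx.
Qed.

(** On the class of (a, i) both sides are g_(t i, t j) applied to [h a]: the point with index [t i]
    and value [b] is [h a] itself. *)
Lemma factor_comm i j (ij : nle i j) (q : lsys_A (assoc_lsys T) i) :
  factor j (lsys_f (assoc_lsys T) ij q) =
  lsys_f (lsys_pull t N) ij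
    (exist _ (factor i (sval q)) (factor_sub (svalP q))).
Proof.
have [a [Ha ->]] := pcgr_imageP q.
transitivity (under_hom j (under_in ij a)).
  by rewrite -factor_pr; congr (factor j _); exact: pcgr_gE.
set b := exist _ _ _.
have le : nle (lsum_p B (existT _ (t i) b)) (t j) by exact: (hom_nle t ij).
transitivity (lsum_f le); last first.
  by congr (lsys_f N _ _); apply: Prop_irrelevance.
apply: lsum_f_congr; symmetry; rewrite /b.
(* Generalising the membership proof makes the rewrite inside the dependent pair well typed. *)
move: (factor_sub _) => /=; rewrite factor_pr => Nb.
by apply: lsum_f_pt; exact: omor_under_idx.
Qed.

Definition factor_mor : lsys_mor (assoc_obj T) B :=
  @LsysMor S (assoc_obj T) B t
    (@LsysHom S I (assoc_lsys T) (lsys_pull t N) factor factor_sub factor_comm).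

Lemma factor_morE : th = over_comp (lallement_mor factor_mor) (canonical_mor T).
Proof.
apply: over_mor_ext => // a; rewrite /= /lsum_map /=; symmetry.
move: (factor_sub _) => /=; rewrite factor_pr => Na.
apply: (@lsum_f_pt _ _ (h a)).
exact: esym (omor_comm th a).
Qed.

End Factor.

End UnderHom.

(** * Uniqueness of the mediating morphism *)

Section Uniqueness.
Variables (S : signature) (X : over_obj S) (B : lsys_obj S) (T : PCgr X).

(** The class of (a, i) in M_j / Theta_j is the image of [pcgr_p T a] under the structure map, with
    which [sv] commutes. So [lmor_u sv] is determined by its composite with the canonical
    morphism. *)
Lemma lmor_u_pr (sv : lsys_mor (assoc_obj T) B) j (x : under_alg j)
    (le : nle (lsum_p B (lsum_map sv (canonical_fun T (under_val x))))
              (lmor_t sv j)) :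
  lmor_u sv j (quot_pr (T j) x) = lsum_f le.
Proof.
case: x le => [[i ij] [a fa]] /= le.
rewrite /under_val /= in le *; have e : oobj_f X a = i by [].
(* [canonical_fun] places [a] in its fiber by [erefl]. *)
subst i; have -> : fa = erefl by apply: Prop_irrelevance.
rewrite -[X in lmor_u sv j X](pcgr_gE ij (imageT (pcgr_p T _) _)).
apply: etrans; first exact: (lsys_hom_comm (lmor_u sv) ij).
by congr (lsys_f _ _ _); apply: Prop_irrelevance.
Qed.

Lemma lallement_canonical_inj (sv sv' : lsys_mor (assoc_obj T) B) :
  over_comp (lallement_mor sv) (canonical_mor T) =
  over_comp (lallement_mor sv') (canonical_mor T) -> sv = sv'.
Proof.
move=> E.
have tE : lmor_t sv = lmor_t sv'.
  apply: surj_hom_ext => i.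
  exact: (congr1 (fun m => omor_t m i) E).
have hE a : lsum_map sv (canonical_fun T a) = lsum_map sv' (canonical_fun T a).
  exact: (congr1 (fun m => omor_h m a) E).
(* The type of [u] depends on [t], so the index maps are identified before the families. *)
move: sv sv' {E} tE hE => [t u] [t' u'] /= tE hE; subst t'.
congr LsysMor; apply: lsys_hom_ext => j q.
rewrite -[q]quot_piK; set x := quot_repr q.
have le (v : lsys_hom (assoc_lsys T) (lsys_pull t (lobj_sys B))) :
    nle (lsum_p B (lsum_map (@LsysMor S (assoc_obj T) B t v)
      (canonical_fun T (under_val x)))) (t j).
  by rewrite /= under_f; apply: hom_nle; apply: under_idx_le.
rewrite [LHS](lmor_u_pr (le u)) [RHS](lmor_u_pr (le u')).
exact: lsum_f_congr.
Qed.

End Uniqueness.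

(** Kept transparent so that the relation reduces to equality where the family is shown to lie in
    [pcgr_below_kernel]. *)
Definition eq_congruence (S : signature) (M : algebra S) : congruence M.
Proof.
exists (@eq M); first by split=> [x|x y z ->|x y ->].
by move=> n s x y xy; congr (op M s _); apply/funext.
Defined.

Lemma eq_congruence_preserves (S : signature) (X : over_obj S)
    (i : oobj_I X) :
  preserves_fiber (eq_congruence (under_alg i)).
Proof. by move=> x y _ _ /quot_piP. Qed.

Theorem theorem6p11 (S : signature) (hS : plural S) (X : over_obj S)
    (B : lsys_obj S) (th : over_mor X (lallement_obj B)) :
  exists D : set (PCgr X), D !=set0 /\
    forall T : PCgr X, D T ->
      exists! sv : lsys_mor (assoc_obj T) B,
        th = over_comp (lallement_mor sv) (canonical_mor T).
Proof.
exists (pcgr_below_kernel th); split.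
  by exists (PCgrFamily (@eq_congruence_preserves S X)) => j x y /= ->.
move=> T DT; exists (factor_mor DT); split; first exact: factor_morE.
move=> sv svE; apply: lallement_canonical_inj.
by rewrite -svE -factor_morE.
Qed.
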